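(* For every $d\ge 2$, $k\ge 1$ and $0\le j\le d-1$, $$\alpha(X(d,k,j))=k+1=\frac{|V(X(d,k,j))|-2-j}{2d-2}+1.$$ For every $d\ge 3$, $k\ge 1$ and $1\le j\le d-1$, $$\alpha(Y(d,k,j))=k+2=\frac{|V(Y(d,k,j))|-2+(d-1-j)}{2d-2}+1.$$
   Context: For a graph $G$, $\alpha(G)$ is the maximum size of a stable set (set of pairwise non-adjacent vertices). The clique complex $\mathit{cl}(G)$ is the simplicial complex of cliques of $G$. Fix integers $d\ge 2$, $k\ge1$. The graph $W_{d,k}$ has vertex set $\{a,b\}\cup X_1\cup\dots\cup X_k$ (pairwise disjoint), where $X_i=\{y^i_1,\dots,y^i_{d-1},z^i_1,\dots,z^i_{d-1}\}$ has $2d-2$ elements. Its edges are: $a$ is adjacent to every vertex of $X_1$ and $b$ to every vertex of $X_k$, with no other edges at $a,b$ (and $ab$ is not an edge); within each $X_i$ all pairs are edges except the pairs $y^i_sz^i_s$, $s=1,\dots,d-1$ (so $W_{d,k}[X_i]$ is the graph of the $(d-1)$-dimensional crosspolytope); there are no edges between $X_i$ and $X_j$ when $|i-j|>1$; for $1\le i\le k-1$ and $s,t\in\{1,\dots,d-1\}$: if $t\ge s$ then $y^i_sy^{i+1}_t$ and $z^i_sz^{i+1}_t$ are edges while $y^i_sz^{i+1}_t$ and $z^i_sy^{i+1}_t$ are not, and if $t<s$ then $y^i_sz^{i+1}_t$ and $z^i_sy^{i+1}_t$ are edges while $y^i_sy^{i+1}_t$ and $z^i_sz^{i+1}_t$ are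 not. There are no other edges. For a simplicial complex $Z$ and an edge $xy$ of $Z$, $Z(xy)$ denotes the stellar subdivision of $Z$ at $xy$ (edge subdivision), which introduces a new vertex $v_{xy}$. Set $X''(d,k,0)=\mathit{cl}(W_{d,k})$ and for $j=1,\dots,d-1$ let $X''(d,k,j)=X''(d,k,j-1)(ay^1_j)$, with new vertex $u_j=v_{ay^1_j}$. Set $Y''(d,k,0)=X''(d,k,d-1)$ and for $j=1,\dots,d-1$ let $Y''(d,k,j)=Y''(d,k,j-1)(by^k_j)$, with new vertex $w_j=v_{by^k_j}$. Let $X(d,k,j)$ and $Y(d,k,j)$ be the graphs ($1$-skeleta) of $X''(d,k,j)$ and $Y''(d,k,j)$ respectively. *)

(* Defs.v *)
From HB Require Import structures.
From mathcomp Require Import all_boot all_order all_algebra.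

Set Implicit Arguments.
Unset Strict Implicit.
Unset Printing Implicit Defensive.

(* Finite simple graphs and finite simplicial complexes whose vertices are
   drawn from a fixed finite type T of names; not every name need be a vertex. *)

Record graph (T : finType) := Graph {
  vertices : {set T};
  adj : rel T;
  adj_sym : symmetric adj;
  adj_irr : irreflexive adj;
  adj_vertices : forall x y, adj x y -> x \in vertices
}.

Definition stable (T : finType) (G : graph T) (S : {set T}) : bool :=
  (S \subset vertices G) &&
  [forall x in S, forall y in S, ~~ adj G x y].

Definition alpha (T : finType) (G : graph T) : nat :=
  \max_(S : {set T} | stable G S) #|S|.

Definition clique (T : finType) (G : graph T) (S : {set T}) : bool :=
  (S \subset vertices G) &&
  [forall x in S, forall y in S, (x != y) ==> adj G x y].

Record complex (T : finType) := Complex {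
  faces : {set {set T}};
  faces_closed : forall A B : {set T}, B \subset A -> A \in faces -> B \in faces
}.

Lemma clique_closed (T : finType) (G : graph T) (A B : {set T}) :
  B \subset A -> A \in [set S | clique G S] -> B \in [set S | clique G S].
Proof.
move=> sBA; rewrite !inE => /andP[sAV /forall_inP cA]; apply/andP; split.
  exact: subset_trans sBA sAV.
apply/forall_inP => x xB; apply/forall_inP => y yB.
exact: (forall_inP (cA x (subsetP sBA _ xB)) y (subsetP sBA _ yB)).
Qed.

Definition clique_complex (T : finType) (G : graph T) : complex T :=
  Complex (@clique_closed T G).

Definition skeleton_vertices (T : finType) (Z : complex T) : {set T} :=
  [set x | [set x] \in faces Z].

Definition skeleton_adj (T : finType) (Z : complex T) : rel T :=
  fun x y => (x != y) && ([set x; y] \in faces Z).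

Lemma skeleton_adj_sym (T : finType) (Z : complex T) :
  symmetric (skeleton_adj Z).
Proof. by move=> x y; rewrite /skeleton_adj eq_sym setUC. Qed.

Lemma skeleton_adj_irr (T : finType) (Z : complex T) :
  irreflexive (skeleton_adj Z).
Proof. by move=> x; rewrite /skeleton_adj eqxx. Qed.

Lemma skeleton_adj_vertices (T : finType) (Z : complex T) x y :
  skeleton_adj Z x y -> x \in skeleton_vertices Z.
Proof.
by case/andP=> _; rewrite inE; apply: faces_closed; exact: subsetUl.
Qed.

Definition skeleton (T : finType) (Z : complex T) : graph T :=
  Graph (@skeleton_adj_sym T Z) (@skeleton_adj_irr T Z)
    (@skeleton_adj_vertices T Z).

(* Stellar subdivision at the edge xy, the new vertex being called v: the faces
   containing xy are replaced by the join of v with the boundary of xy and with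
   the link of xy.  Meaningful when xy is an edge and v is not a vertex of Z. *)
Definition subdivision_faces (T : finType) (Z : complex T) (x y v : T) :
    {set {set T}} :=
  [set A in faces Z | ~~ ([set x; y] \subset A)] :|:
  [set v |: A | A : {set T} &
     ~~ ([set x; y] \subset A) && (A :|: [set x; y] \in faces Z)].

Lemma subdivision_closed (T : finType) (Z : complex T) (x y v : T)
    (A B : {set T}) :
  B \subset A -> A \in subdivision_faces Z x y v ->
  B \in subdivision_faces Z x y v.
Proof.
move=> sBA /setUP[|/imsetP[C]].
  rewrite inE => /andP[AZ nA]; apply/setUP; left; rewrite inE.
  rewrite (faces_closed sBA AZ) /=; apply: contra nA => sB.
  exact: (subset_trans sB sBA).
rewrite inE => /andP[nC CZ] defA; apply/setUP.
have nsub (D : {set T}) : D \subset C -> ~~ ([set x; y] \subset D).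
  by move=> sDC; apply: contra nC => sD; exact: (subset_trans sD sDC).
have sDC : B :\ v \subset C by rewrite subDset -defA.
have [vB|vNB] := boolP (v \in B); [right | left].
  apply/imsetP; exists (B :\ v); last by rewrite setD1K.
  by rewrite inE nsub //= (faces_closed _ CZ) // setSU.
have sBC : B \subset C by move: sDC; rewrite (setDidPl _) // disjoint_sym disjoints1.
rewrite inE nsub // andbT; apply: faces_closed CZ.
exact: subset_trans sBC (subsetUl _ _).
Qed.

Definition subdivision (T : finType) (Z : complex T) (x y v : T) : complex T :=
  Complex (@subdivision_closed T Z x y v).

(* Names of all vertices that occur.  Indices are those of the mathematics,
   starting at 1; the names with an index out of range (such as 0) are never
   vertices of the graphs and complexes considered. *)
Inductive vname (d k : nat) :=
  | Na | Nb
  | Ny of 'I_k.+1 & 'I_d.+1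
  | Nz of 'I_k.+1 & 'I_d.+1
  | Nu of 'I_d.+1
  | Nw of 'I_d.+1.

Arguments Na {d k}.
Arguments Nb {d k}.
Arguments Ny {d k}.
Arguments Nz {d k}.
Arguments Nu {d k}.
Arguments Nw {d k}.

Definition vname_encode (d k : nat) (v : vname d k) :
    bool + (bool * 'I_k.+1 * 'I_d.+1 + bool * 'I_d.+1) :=
  match v with
  | Na => inl true
  | Nb => inl false
  | Ny i s => inr (inl (true, i, s))
  | Nz i s => inr (inl (false, i, s))
  | Nu s => inr (inr (true, s))
  | Nw s => inr (inr (false, s))
  end.

Definition vname_decode (d k : nat)
    (c : bool + (bool * 'I_k.+1 * 'I_d.+1 + bool * 'I_d.+1)) : vname d k :=
  match c with
  | inl true => Na
  | inl false => Nb
  | inr (inl (true, i, s)) => Ny i s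
  | inr (inl (false, i, s)) => Nz i s
  | inr (inr (true, s)) => Nu s
  | inr (inr (false, s)) => Nw s
  end.

Lemma vname_encodeK (d k : nat) : cancel (@vname_encode d k) (@vname_decode d k).
Proof. by case. Qed.

HB.instance Definition _ (d k : nat) :=
  Finite.copy (vname d k) (can_type (@vname_encodeK d k)).

Definition vy {d k : nat} (i s : nat) : vname d k := Ny (inord i) (inord s).
Definition vu {d k : nat} (s : nat) : vname d k := Nu (inord s).
Definition vw {d k : nat} (s : nat) : vname d k := Nw (inord s).

Definition W_vertices (d k : nat) : {set vname d k} :=
  [set v | match v with
           | Na | Nb => true
           | Ny i s | Nz i s => (0 < i) && (0 < s < d)
           | Nu _ | Nw _ => false
           end].

(* Each edge of W_{d,k} in at least one of its two orientations. *)
Definition W_arc (d k : nat) (x y : vname d k) : bool :=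
  match x, y with
  | Na, (Ny i _ | Nz i _) => i == 1 :> nat
  | Nb, (Ny i _ | Nz i _) => i == k :> nat
  | Ny i s, Ny j t | Nz i s, Nz j t =>
      (i == j) && (s != t) || (j == i.+1 :> nat) && (s <= t)
  | Ny i s, Nz j t | Nz i s, Ny j t =>
      (i == j) && (s != t) || (j == i.+1 :> nat) && (t < s)
  | _, _ => false
  end.

Definition W_adj (d k : nat) : rel (vname d k) :=
  fun x y => [&& x \in W_vertices d k, y \in W_vertices d k &
                 W_arc x y || W_arc y x].

Lemma W_adj_sym (d k : nat) : symmetric (@W_adj d k).
Proof. by move=> x y; rewrite /W_adj andbCA orbC. Qed.

Lemma W_adj_irr (d k : nat) : irreflexive (@W_adj d k).
Proof.
move=> x; rewrite /W_adj orbb; apply/negbTE; rewrite !negb_and.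
by case: x => [||i s|i s|s|s] /=; rewrite ?orbT // !eqxx (ltn_eqF (ltnSn i)) !orbT.
Qed.

Lemma W_adj_vertices (d k : nat) (x y : vname d k) :
  W_adj x y -> x \in W_vertices d k.
Proof. by case/and3P. Qed.

Definition W (d k : nat) : graph (vname d k) :=
  Graph (@W_adj_sym d k) (@W_adj_irr d k) (@W_adj_vertices d k).

Fixpoint Xcomplex (d k j : nat) : complex (vname d k) :=
  match j with
  | 0 => clique_complex (W d k)
  | j'.+1 => subdivision (Xcomplex d k j') Na (vy 1 j'.+1) (vu j'.+1)
  end.

Fixpoint Ycomplex (d k j : nat) : complex (vname d k) :=
  match j with
  | 0 => Xcomplex d k d.-1
  | j'.+1 => subdivision (Ycomplex d k j') Nb (vy k j'.+1) (vw j'.+1)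
  end.

Definition X (d k j : nat) : graph (vname d k) := skeleton (Xcomplex d k j).
Definition Y (d k j : nat) : graph (vname d k) := skeleton (Ycomplex d k j).

(* In the range of indices of interest, every subdivision above is performed at
   an edge and introduces a new vertex: X_edge, X_fresh, Y_edge, Y_fresh. *)

Lemma subdivision_keep (T : finType) (Z : complex T) (x y v : T) (A : {set T}) :
  A \in faces Z -> ~~ ([set x; y] \subset A) ->
  A \in faces (subdivision Z x y v).
Proof. by move=> AZ nA; apply/setUP; left; rewrite inE AZ. Qed.

Lemma subdivision_vertex (T : finType) (Z : complex T) (x y v p : T) :
  p \in vertices (skeleton (subdivision Z x y v)) ->
  p = v \/ p \in vertices (skeleton Z).
Proof.
rewrite !inE => /orP[/andP[pZ _]|/imsetP[A _ pA]]; first by right.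
by left; apply/esym/set1P; rewrite pA setU11.
Qed.

Lemma vy_inj (d k i s t : nat) :
  s < d -> t < d -> vy i s = vy i t :> vname d k -> s = t.
Proof.
by move=> sd td [] /(congr1 val); rewrite /= !inordK // ltnS ltnW.
Qed.

Lemma W_edge (d k s : nat) : 0 < k -> 0 < s < d ->
  [set Na; vy 1 s] \in faces (clique_complex (W d k)) /\
  [set Nb; vy k s] \in faces (clique_complex (W d k)).
Proof.
move=> k0 /andP[s0 sd]; have sd' : s < d.+1 by rewrite ltnS ltnW.
have F (x y : vname d k) : W_adj x y ->
    [set x; y] \in faces (clique_complex (W d k)).
  move=> xy; have yx : W_adj y x by rewrite W_adj_sym.
  rewrite inE; apply/andP; split.
    by rewrite subUset !sub1set (W_adj_vertices xy) (W_adj_vertices yx).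
  apply/forall_inP => p /set2P[] ->; apply/forall_inP => q /set2P[] ->;
    by rewrite ?eqxx //= ?xy ?yx ?implybT.
by split; apply: F; rewrite /W_adj !inE /= !inordK // ?s0 ?sd ?k0 ?eqxx.
Qed.

Lemma Xcomplex_edges (d k j s : nat) : 0 < k -> j < s < d ->
  [set Na; vy 1 s] \in faces (Xcomplex d k j).
Proof.
move=> k0; elim: j => [|j IHj] /andP[js sd] /=.
  by have [|] := @W_edge d k s k0; rewrite ?js.
apply: subdivision_keep; first by apply: IHj; rewrite (ltnW js).
apply/negP => /subsetP/(_ _ (set22 _ _))/set2P[//|].
by move/(vy_inj (ltn_trans js sd) sd) => e; rewrite e ltnn in js.
Qed.

Lemma Ycomplex_edges (d k j s : nat) : 0 < k -> j < s < d ->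
  [set Nb; vy k s] \in faces (Ycomplex d k j).
Proof.
move=> k0; elim: j => [|j IHj] /andP[js sd] /=.
  elim: d.-1 => [|m IHm] /=; first by have [|] := @W_edge d k s k0; rewrite ?js.
  apply: subdivision_keep => //.
  by apply/negP => /subsetP/(_ _ (set21 _ _))/set2P[].
apply: subdivision_keep; first by apply: IHj; rewrite (ltnW js).
apply/negP => /subsetP/(_ _ (set22 _ _))/set2P[//|].
by move/(vy_inj (ltn_trans js sd) sd) => e; rewrite e ltnn in js.
Qed.

Lemma X_edge (d k j : nat) : 0 < k -> j.+1 < d ->
  adj (X d k j) Na (vy 1 j.+1).
Proof.
move=> k0 jd; apply/andP; split=> //.
by apply: Xcomplex_edges => //; rewrite ltnSn.
Qed.

Lemma Y_edge (d k j : nat) : 0 < k -> j.+1 < d ->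
  adj (Y d k j) Nb (vy k j.+1).
Proof.
move=> k0 jd; apply/andP; split=> //.
by apply: Ycomplex_edges => //; rewrite ltnSn.
Qed.

Lemma X_vertex (d k j : nat) (p : vname d k) : p \in vertices (X d k j) ->
  p \in W_vertices d k \/ exists2 s, 0 < s <= j & p = vu s.
Proof.
elim: j => [|j IHj].
  by rewrite inE /= inE => /andP[]; rewrite sub1set; left.
move=> /subdivision_vertex[->|/IHj[|[s /andP[s0 sj] ->]]]; [right|by left|right].
  by exists j.+1; rewrite ?leqnn.
by exists s; rewrite // s0 leqW.
Qed.

Lemma Y_vertex (d k j : nat) (p : vname d k) : p \in vertices (Y d k j) ->
  p \in vertices (X d k d.-1) \/ exists2 s, 0 < s <= j & p = vw s.
Proof.
elim: j => [|j IHj]; first by left.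
move=> /subdivision_vertex[->|/IHj[|[s /andP[s0 sj] ->]]]; [right|by left|right].
  by exists j.+1; rewrite ?leqnn.
by exists s; rewrite // s0 leqW.
Qed.

Lemma X_fresh (d k j : nat) : j.+1 < d -> vu j.+1 \notin vertices (X d k j).
Proof.
move=> jd; apply/negP => /X_vertex[|[s /andP[_ sj] []]]; first by rewrite inE.
have sd : s < d.+1 by rewrite ltnS (leq_trans sj (ltnW (ltnW jd))).
move=> /(congr1 val); rewrite /= !inordK // ?ltnS 1?ltnW // => e.
by rewrite -e ltnn in sj.
Qed.

Lemma Y_fresh (d k j : nat) : j.+1 < d -> vw j.+1 \notin vertices (Y d k j).
Proof.
move=> jd; apply/negP => /Y_vertex[/X_vertex[|[]//]|[s /andP[_ sj] []]].
  by rewrite inE.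
have sd : s < d.+1 by rewrite ltnS (leq_trans sj (ltnW (ltnW jd))).
move=> /(congr1 val); rewrite /= !inordK // ?ltnS 1?ltnW // => e.
by rewrite -e ltnn in sj.
Qed.

(* Main.v *)
(* Split the vertices of X(d,k,j) and Y(d,k,j) into levels: the clique
   {a, u_1, u_2, ...}, then X_1, ..., X_k, then the clique {b, w_1, w_2, ...}.
   Within a level, only the pairs y^i_s z^i_s are non-adjacent, and every vertex
   of a level next to X_i is adjacent to y^i_s or to z^i_s.  So a stable set has
   at most 1 vertex in the first level and at most 2 in the union of two
   consecutive levels, hence at most n in the first n levels.  There are k + 2
   levels; in X(d,k,j) the vertex b is moreover adjacent to all of X_k, which
   saves one.  Since only triangles {x, y, q} decide whether the vertex v_xy is
   adjacent to q, the full face structure is never needed. *)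

Require Import Defs.
From mathcomp Require Import all_boot all_order all_algebra.
From mathcomp Require Import zify ring.

Set Implicit Arguments.
Unset Strict Implicit.
Unset Printing Implicit Defensive.

(** * Faces and vertices of one edge subdivision *)

Section Subdivision.
Variables (T : finType) (Z : complex T) (x y v : T).
Implicit Types A : {set T}.

Lemma subdivision_join A :
  ~~ ([set x; y] \subset A) -> A :|: [set x; y] \in faces Z ->
  v |: A \in faces (subdivision Z x y v).
Proof.
by move=> nA AZ; apply/setUP; right; apply/imsetP; exists A; rewrite // inE nA.
Qed.

Lemma subdivision_old A : v \notin A -> A \in faces (subdivision Z x y v) ->
  A \in faces Z /\ ~~ ([set x; y] \subset A).
Proof.
move=> vA /setUP[|/imsetP[B _ eA]]; first by rewrite inE => /andP.
by rewrite eA setU11 in vA.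
Qed.

(** As [v] is new, a face through it can only be some [v |: B] where [B] together with the edge
    spans a face of [Z]; and [q] lies in [B]. *)
Lemma subdivision_link q : [set v] \notin faces Z -> q != v ->
  [set v; q] \in faces (subdivision Z x y v) -> q |: [set x; y] \in faces Z.
Proof.
move=> vZ qv /setUP[|/imsetP[B]].
  rewrite inE => /andP[/(faces_closed (subsetUl _ _)) vZ' _].
  by rewrite vZ' in vZ.
rewrite inE => /andP[_ BZ] eB; apply: faces_closed BZ; apply: setSU.
have: q \in v |: B by rewrite -eB set22.
by rewrite sub1set !inE (negPf qv).
Qed.

Lemma card_subdivision_vertices :
  adj (skeleton Z) x y -> v \notin vertices (skeleton Z) ->
  #|vertices (skeleton (subdivision Z x y v))| =
    #|vertices (skeleton Z)|.+1.
Proof.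
move=> /andP[xy xyZ] vZ; rewrite -[RHS]add1n -[1](congr1 nat_of_bool vZ) -cardsU1.
apply: eq_card => p; apply/idP/idP.
  by move/subdivision_vertex => [->|pZ]; rewrite in_setU1 ?eqxx // pZ orbT.
rewrite in_setU1 => /orP[/eqP->|pZ]; rewrite inE.
  (* The new vertex is the join of [v] with the empty face. *)
  rewrite -[[set v]]setU0; apply: subdivision_join; last by rewrite set0U.
  by rewrite subset0; apply/set0Pn; exists x; rewrite set21.
rewrite inE in pZ; apply: subdivision_keep => //.
rewrite subUset !sub1set !inE; apply: contra xy => /andP[/eqP-> /eqP->].
exact: eqxx.
Qed.

End Subdivision.

(** * Successive subdivisions at edges with a common endpoint *)

Section Subdivisions.
Variables (T : finType) (Z : complex T) (a : T) (y v : nat -> T).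
Implicit Types A : {set T}.

(** Abstracting over the endpoint [a] and the sequences [y], [v] lets the same lemmas serve both the
    subdivisions at $a$ and those at $b$. *)
Fixpoint subdivisions n : complex T :=
  if n is n'.+1 then subdivision (subdivisions n') a (y n) (v n) else Z.

(** Stage [s] destroys only the faces that contain both [a] and [y s]. *)
Lemma subdivisions_keep i n A : i <= n -> A \in faces (subdivisions i) ->
  (forall s, i < s <= n -> a \in A -> y s \notin A) ->
  A \in faces (subdivisions n).
Proof.
elim: n => [|n IHn] in_; first by move: in_; rewrite leqn0 => /eqP->.
move: in_; rewrite leq_eqVlt => /orP[/eqP->//|lein] AZ nA.
apply: subdivision_keep.
  by apply: IHn => // s /andP[is_ sn]; apply: nA; rewrite is_ leqW.
rewrite subUset !sub1set; apply/negP => /andP[aA yA].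
by have := nA n.+1; rewrite yA lein leqnn => /(_ isT aA).
Qed.

Lemma subdivisions_keep0 n A : A \in faces Z ->
  (forall s, 0 < s <= n -> a \in A -> y s \notin A) ->
  A \in faces (subdivisions n).
Proof. by move=> AZ; apply: (subdivisions_keep (leq0n n)). Qed.

(** A face that avoids the vertices introduced after stage [i] was not created by those stages, so
    it was already present and none of them destroyed it. *)
Lemma subdivisions_old i n A : i <= n -> (forall s, i < s <= n -> v s \notin A) ->
  A \in faces (subdivisions n) ->
  A \in faces (subdivisions i) /\ (forall s, i < s <= n -> a \in A -> y s \notin A).
Proof.
elim: n => [|n IHn] in_ vA.
  move: in_; rewrite leqn0 => /eqP-> AZ; split=> // s.
  by case: s.
move: in_; rewrite leq_eqVlt => /orP[/eqP-> AZ|lein].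
  by split=> // s; rewrite ltnNge; case: (s <= n.+1).
case/subdivision_old => [|AZ nA]; first by apply: vA; rewrite lein leqnn.
case: (IHn _ _ AZ) => // [s /andP[is_ sn]|Ai H].
  by apply: vA; rewrite is_ leqW.
split=> // s /andP[is_]; rewrite leq_eqVlt => /orP[/eqP-> aA|sn].
  by apply: contra nA => yA; rewrite subUset !sub1set aA.
by apply: H; rewrite is_.
Qed.

Lemma subdivisions_vertex n p : p \in vertices (skeleton (subdivisions n)) ->
  p \in vertices (skeleton Z) \/ exists2 s, 0 < s <= n & p = v s.
Proof.
elim: n => [|n IHn]; first by left.
case/subdivision_vertex=> [->|/IHn[|[s /andP[s0 sn] ->]]]; [right|by left|right].
  by exists n.+1; rewrite ?leqnn.
by exists s; rewrite // s0 leqW.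
Qed.

Hypothesis ay : forall s, a != y s.

Lemma vertices_subdivisions n p : p \in vertices (skeleton Z) ->
  p \in vertices (skeleton (subdivisions n)).
Proof.
rewrite !inE => pZ; apply: subdivisions_keep0 => // s _; rewrite !inE => /eqP<-.
by rewrite eq_sym ay.
Qed.

Hypotheses (va : forall s, v s != a) (vy : forall r s, v r != y s).

(** The triangle on [q], [a], [y s] contains no earlier [y r], so it is intact when stage [s] turns
    it into the edge from [v s] to [q]. Later stages keep this edge: if it contains [a] then [q] is
    [a], and no [y r] lies in it. *)
Lemma subdivisions_join n s q : 0 < s <= n ->
  q |: [set a; y s] \in faces Z ->
  (forall r, 0 < r < s -> y r != q /\ y r != y s) ->
  [set v s; q] \in faces (subdivisions n).
Proof.
case: s => // s /andP[_ sn] qZ yr.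
apply: (@subdivisions_keep s.+1) => //.
  apply: subdivision_join.
    rewrite subUset !sub1set !inE; apply/negP => /andP[/eqP aq /eqP yq].
    by have := ay s.+1; rewrite aq yq eqxx.
  apply: subdivisions_keep0 => // r rs _; have [yq ys] := yr _ rs.
  by rewrite !inE !negb_or yq ys eq_sym ay.
move=> r _; rewrite !inE ![_ == v _]eq_sym (negPf (va _)) (negPf (vy _ _)) /=.
by move/eqP <-; rewrite eq_sym ay.
Qed.

(** Stage [r] turns the triangle [a], [y r], [y s] into the triangle [v r], [a], [y s], which in
    turn gives the edge from [v r] to [v s] at stage [s]. The proof goes through the stages
    backwards. *)
Lemma subdivisions_join_new n r s : 0 < r < s -> s <= n ->
  [set a; y r; y s] \in faces Z ->
  (forall t, 0 < t < s -> y t != y s) -> (forall t, 0 < t < r -> y t != y r) ->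
  [set v r; v s] \in faces (subdivisions n).
Proof.
case: r => // r; case: s => // s /andP[_ rs] sn rsZ ys yr.
apply: (@subdivisions_keep s.+1) => //; last first.
  by move=> t _; rewrite !inE ![a == _]eq_sym !(negPf (va _)).
rewrite setUC; apply: subdivision_join.
  by rewrite subUset sub1set inE eq_sym (negPf (va _)).
apply: (@subdivisions_keep r.+1) => //; last first.
  move=> t /andP[rt ts] _; rewrite !inE ![_ == v _]eq_sym (negPf (vy _ _)).
  rewrite eq_sym (negPf (ay _)) /=; apply: ys.
  by rewrite ltnS ts andbT (leq_trans _ rt).
apply: subdivision_join.
  by rewrite subUset !sub1set !inE eqxx /= eq_sym negb_or ay ys.
apply: subdivisions_keep0 => //.
  by apply: faces_closed rsZ; rewrite !subUset !sub1set !inE !eqxx !orbT.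
move=> t /andP[t0 tr] _; rewrite !inE ![_ == a]eq_sym !(negPf (ay _)) /= negb_or.
by rewrite ys ?yr ?t0 // (leq_trans (tr : t < r.+1) (ltnW rs)).
Qed.

End Subdivisions.

(** * Counting by levels, and stable sets given as sequences *)

Lemma leq_card_levels (T : finType) (f : T -> nat) (S : {set T}) :
  #|[set x in S | f x == 0]| <= 1 ->
  (forall i, #|[set x in S | f x == i]| + #|[set x in S | f x == i.+1]| <= 2) ->
  forall m, #|[set x in S | f x < m]| <= m.
Proof.
move=> l0 l2.
have cS m : #|[set x in S | f x < m.+1]| =
    #|[set x in S | f x < m]| + #|[set x in S | f x == m]|.
  rewrite -cardsUI (_ : _ :&: _ = set0) ?cards0 ?addn0.
    by apply: eq_card => x; rewrite !inE ltnS leq_eqVlt orbC andb_orr.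
  by apply/setP=> x; rewrite !inE; case: eqP => [->|]; rewrite ?ltnn !andbF.
have c0 : #|[set x in S | f x < 0]| = 0.
  by apply: eq_card0 => x; rewrite !inE andbF.
(* The induction adds two levels at a time, so two consecutive bounds are carried along. *)
have IH m : #|[set x in S | f x < m]| <= m /\ #|[set x in S | f x < m.+1]| <= m.+1.
  elim: m => [|m [IHm IHm1]]; first by rewrite cS c0.
  split=> //; rewrite !cS -addnA -addn2; exact: leq_add.
by move=> m; have [] := IH m.
Qed.

(** The left inverse [g] certifies that the [n] listed vertices are distinct. *)
Lemma leq_alpha (T : finType) (G : graph T) n (f : nat -> T) (g : T -> nat) :
  {in gtn n, cancel f g} -> {in gtn n, forall i, f i \in vertices G} ->
  {in gtn n &, forall i j, ~~ adj G (f i) (f j)} -> n <= alpha G.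
Proof.
move=> fK fV fS; pose S := [set f (val i) | i in 'I_n].
have <- : #|S| = n.
  rewrite card_imset ?card_ord // => i j /(congr1 g).
  by rewrite !fK ?[_ \in _]ltn_ord // => /val_inj.
apply: (@leq_bigmax_cond _ (stable G) (fun S => #|S|)); apply/andP; split.
  by apply/subsetP => _ /imsetP[i _ ->]; apply: fV; apply: ltn_ord.
apply/forall_inP => _ /imsetP[i _ ->]; apply/forall_inP => _ /imsetP[j _ ->].
by apply: fS; apply: ltn_ord.
Qed.

(** * Vertices, edges and triangles of $W_{d,k}$ *)

Lemma card_vname_W (d k : nat) : 0 < d -> #|W_vertices d k| = 2 + k * (2 * d - 2).
Proof.
move=> d0.
pose I := [set i : 'I_k.+1 | 0 < i]; pose J := [set s : 'I_d.+1 | 0 < s < d].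
have cI : #|I| = k.
  rewrite -[RHS]/(k.+1.-1) -[in RHS](card_ord k.+1) -(cardsC1 ord0).
  by apply: eq_card => i; rewrite !inE lt0n.
have cJ : #|J| = d.-1.
  (* The out-of-range second indices are 0 and [d], which differ since [d] is positive. *)
  have : #|J| + #|[set ord0; ord_max : 'I_d.+1]| = d.+1.
    rewrite -[RHS]card_ord -(cardsC J); congr (_ + _); apply: eq_card => s.
    rewrite !inE -!val_eqE /=; have := ltn_ord s; lia.
  rewrite cards2 -val_eqE /=; lia.
pose F (b : bool) (p : 'I_k.+1 * 'I_d.+1) : vname d k :=
  if b then Ny p.1 p.2 else Nz p.1 p.2.
have FI b : injective (F b).
  by case: b => -[i s] [i' s'] [-> ->].
have -> : W_vertices d k =
    [set Na; Nb] :|: (F true @: setX I J :|: F false @: setX I J).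
  apply/setP=> -[||i s|i s|s|s]; rewrite !inE /=.
  - done.
  - done.
  - apply/idP/orP => [h|[/imsetP[[i' s']]|/imsetP[[i' s']]]] //.
      by left; apply/imsetP; exists (i, s); rewrite ?inE.
    by rewrite !inE /= => h [-> ->].
  - apply/idP/orP => [h|[/imsetP[[i' s']]|/imsetP[[i' s']]]] //.
      by right; apply/imsetP; exists (i, s); rewrite ?inE.
    by rewrite !inE /= => h [-> ->].
  - by apply/esym/norP; split; apply/imsetP => -[[]].
  - by apply/esym/norP; split; apply/imsetP => -[[]].
rewrite cardsU (_ : _ :&: _ = set0); last first.
  apply/setP=> x; rewrite !inE; apply/negP => /andP[/orP[]/eqP->].
    by case/orP => /imsetP[[]].
  by case/orP => /imsetP[[]].
rewrite cards0 subn0 cards2 /=.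
rewrite cardsU (_ : _ :&: _ = set0); last first.
  apply/setP=> x; rewrite !inE; apply/negP => /andP[/imsetP[[i s] _ ->]].
  by case/imsetP => -[].
rewrite cards0 subn0 !card_imset // cardsX cI cJ; nia.
Qed.

Lemma Xcomplex_subdivisions d k n :
  Xcomplex d k n = subdivisions (clique_complex (W d k)) Na (vy 1) vu n.
Proof. by elim: n => //= n ->. Qed.

Lemma Ycomplex_subdivisions d k n :
  Ycomplex d k n = subdivisions (Xcomplex d k d.-1) Nb (vy k) vw n.
Proof. by elim: n => //= n ->. Qed.

Lemma Ny_vy d k (i : 'I_k.+1) (s : 'I_d.+1) n :
  i = n :> nat -> Ny i s = vy n s.
Proof. by move=> <-; rewrite /vy !inord_val. Qed.

Lemma vy_neq d k i r s : r < s < d -> (vy i r : vname d k) != vy i s.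
Proof.
case/andP=> rs sd; apply/eqP => /(vy_inj (ltn_trans rs sd) sd) e.
by rewrite e ltnn in rs.
Qed.

Lemma W_face2 d k (p q : vname d k) :
  ([set p; q] \in faces (clique_complex (W d k))) =
  [&& p \in W_vertices d k, q \in W_vertices d k & (p == q) || W_adj p q].
Proof.
rewrite inE /clique subUset !sub1set -andbA; do 2!congr (_ && _).
apply/forall_inP/orP => [/(_ p (set21 _ _))/forall_inP/(_ q (set22 _ _))|].
  by case: eqP => //= _; [left|right].
move=> pq x /set2P[]->; apply/forall_inP => y /set2P[]->; rewrite ?eqxx //=.
  by case: pq => [/eqP->|->]; rewrite ?eqxx ?implybT.
by case: pq => [/eqP->|]; rewrite ?eqxx // W_adj_sym => ->; rewrite implybT.
Qed.

Lemma W_face3 d k (p q r : vname d k) :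
  W_adj p q -> W_adj p r -> W_adj q r ->
  p |: [set q; r] \in faces (clique_complex (W d k)).
Proof.
move=> pq pr qr.
have rp : W_adj r p by rewrite W_adj_sym.
have qp : W_adj q p by rewrite W_adj_sym.
have rq : W_adj r q by rewrite W_adj_sym.
rewrite inE; apply/andP; split.
  rewrite !subUset !sub1set (W_adj_vertices pq) (W_adj_vertices qr).
  exact: W_adj_vertices rp.
apply/forall_inP => x; rewrite !inE => Hx; apply/forall_inP => y; rewrite !inE => Hy.
apply/implyP => /=.
by case/or3P: Hx => /eqP->; case/or3P: Hy => /eqP->; rewrite ?eqxx.
Qed.

(** * The upper bound by levels *)

Section Levels.
Variables d k : nat.
Implicit Types (i : 'I_k.+1) (s t : 'I_d.+1) (p q : vname d k).

Definition level p : nat :=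
  match p with
  | Na | Nu _ => 0
  | Ny i _ | Nz i _ => i
  | Nb | Nw _ => k.+1
  end.

(** It fixes every name outside the $X_i$, so on the two end levels only equal vertices are excluded
    in [level_adj]. *)
Definition antipode p : vname d k :=
  match p with
  | Ny i s => Nz i s
  | Nz i s => Ny i s
  | _ => p
  end.

Variables j m : nat.
Hypotheses (k_gt0 : 0 < k) (jd : j < d) (md : m < d).

(** Covers both families: [m = 0] gives $X''(d,k,j)$, and [j = d.-1] gives $Y''(d,k,m)$. *)
Definition XYcomplex : complex (vname d k) :=
  subdivisions (Xcomplex d k j) Nb (vy k) vw m.

Definition XY_vertex p : bool :=
  match p with
  | Na | Nb => true
  | Ny i s | Nz i s => (0 < i) && (0 < s < d)
  | Nu s => 0 < s <= j
  | Nw s => 0 < s <= m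
  end.

Lemma vertices_XY p : p \in vertices (skeleton XYcomplex) -> XY_vertex p.
Proof.
case/subdivisions_vertex => [/X_vertex[]|].
- by rewrite inE; case: p.
- case=> s /andP[s0 sj] -> /=; rewrite inordK ?s0 //.
  by rewrite ltnS (leq_trans sj) // ltnW.
case=> s /andP[s0 sm] -> /=; rewrite inordK ?s0 //.
by rewrite ltnS (leq_trans sm) // ltnW.
Qed.

Lemma XY_keep (A : {set vname d k}) :
  A \in faces (Xcomplex d k j) ->
  (forall r, 0 < r <= m -> Nb \in A -> vy k r \notin A) ->
  A \in faces XYcomplex.
Proof. exact: subdivisions_keep0. Qed.

Lemma X_keep (A : {set vname d k}) :
  A \in faces (clique_complex (W d k)) -> Na \notin A ->
  A \in faces (Xcomplex d k j).
Proof.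
rewrite Xcomplex_subdivisions => AX nA.
by apply: subdivisions_keep0 => // s _; rewrite (negPf nA).
Qed.

Lemma XY_W p q : W_adj p q ->
  (forall r, 0 < r <= j -> Na \in [set p; q] -> vy 1 r \notin [set p; q]) ->
  (forall r, 0 < r <= m -> Nb \in [set p; q] -> vy k r \notin [set p; q]) ->
  [set p; q] \in faces XYcomplex.
Proof.
move=> pq ha hb; apply: XY_keep => //.
rewrite Xcomplex_subdivisions; apply: subdivisions_keep0 => //=.
rewrite W_face2 pq (W_adj_vertices pq) orbT andbT /=.
by rewrite W_adj_sym in pq; apply: W_adj_vertices pq.
Qed.

(** The last hypothesis keeps the triangle intact until stage [s]; with [q != Nb] the resulting edge
    avoids $b$ and survives the second family. *)
Lemma XY_u s q : 0 < s <= j -> q != Nb ->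
  q |: [set Na; vy 1 s] \in faces (clique_complex (W d k)) ->
  (forall r, 0 < r < s -> vy 1 r != q) -> [set Nu s; q] \in faces XYcomplex.
Proof.
move=> sj qb qW yq; apply: XY_keep; last first.
  by move=> r _ /set2P[//|e]; rewrite -e eqxx in qb.
have -> : Nu s = vu s :> vname d k by rewrite /vu inord_val.
rewrite Xcomplex_subdivisions; apply: subdivisions_join => // r /andP[r0 rs].
rewrite yq ?r0 //; split=> //; apply: vy_neq.
by case/andP: sj => _ sj; rewrite rs (leq_ltn_trans sj).
Qed.

(** Here the triangle must first survive all subdivisions at $a$, which it does because it avoids
    $a$. *)
Lemma XY_w s q : 0 < s <= m -> q != Na ->
  q |: [set Nb; vy k s] \in faces (clique_complex (W d k)) ->
  (forall r, 0 < r < s -> vy k r != q) -> [set Nw s; q] \in faces XYcomplex.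
Proof.
move=> sm qa qW yq.
have -> : Nw s = vw s :> vname d k by rewrite /vw inord_val.
apply: subdivisions_join => //.
  apply: X_keep => //; apply/negP => /setU1P[e|/set2P[]//].
  by rewrite e eqxx in qa.
move=> r /andP[r0 rs]; rewrite yq ?r0 //; split=> //; apply: vy_neq.
by case/andP: sm => _ sm; rewrite rs (leq_ltn_trans sm).
Qed.

Lemma XY_uu s t : 0 < s -> s < t <= j -> [set Nu s; Nu t] \in faces XYcomplex.
Proof.
move=> s0 /andP[st tj]; apply: XY_keep; last by move=> r _; rewrite !inE.
have vuE r : Nu r = vu r :> vname d k by rewrite /vu inord_val.
have td := leq_ltn_trans tj jd.
rewrite Xcomplex_subdivisions !vuE.
apply: (@subdivisions_join_new _ _ _ _ _ _ _ _ j s t) => //; rewrite ?s0 //.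
- rewrite -setUA; apply: W_face3; rewrite /W_adj !inE /= -?val_eqE /= ?inordK //; lia.
- by move=> r /andP[_ rt]; apply: vy_neq; rewrite rt.
by move=> r /andP[_ rs]; apply: vy_neq; rewrite rs (ltn_trans st).
Qed.

Lemma XY_ww s t : 0 < s -> s < t <= m -> [set Nw s; Nw t] \in faces XYcomplex.
Proof.
move=> s0 /andP[st tm].
have vwE r : Nw r = vw r :> vname d k by rewrite /vw inord_val.
have td := leq_ltn_trans tm md.
rewrite !vwE; apply: (@subdivisions_join_new _ _ _ _ _ _ _ _ m s t); rewrite ?s0 //.
- apply: X_keep; last by rewrite !inE.
  rewrite -setUA; apply: W_face3; rewrite /W_adj !inE /= -?val_eqE /= ?inordK //; lia.
- by move=> r /andP[_ rt]; apply: vy_neq; rewrite rt.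
by move=> r /andP[_ rs]; apply: vy_neq; rewrite rs (ltn_trans st).
Qed.

Lemma XY_au s : 0 < s <= j -> [set Nu s; Na] \in faces XYcomplex.
Proof.
move=> sj; apply: XY_u => //.
rewrite setUA setUid W_face2 /W_adj !inE /= ?inordK //; have := ltn_ord s; lia.
Qed.

Lemma XY_bw s : 0 < s <= m -> [set Nw s; Nb] \in faces XYcomplex.
Proof.
move=> sm; apply: XY_w => //.
rewrite setUA setUid W_face2 /W_adj !inE /= ?inordK //; have := ltn_ord s; lia.
Qed.

(** Edges inside an $X_i$ contain neither $a$ nor $b$, so they are never subdivided; the end levels
    are cliques by [XY_au], [XY_uu], [XY_bw] and [XY_ww]. *)
Lemma level_adj p q : XY_vertex p -> XY_vertex q -> level p = level q ->
  p != q -> q != antipode p -> [set p; q] \in faces XYcomplex.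
Proof.
case: p => [||i s|i s|s|s]; case: q => [||i' t|i' t|t|t] //=;
  rewrite ?eqxx // => Hp Hq e ne na;
  try (have lti := ltn_ord i); try (have lti' := ltn_ord i'); try lia.
- by rewrite setUC; apply: XY_au.
- by rewrite setUC; apply: XY_bw.
- have {e} e : i = i' := ord_inj e; subst i'.
  have {}ne : s != t by apply: contra ne => /eqP->.
  by apply: XY_W => [|r _ /set2P[]|r _ /set2P[]] //; 
    rewrite /W_adj !inE /= Hp Hq eqxx ne.
- have {e} e : i = i' := ord_inj e; subst i'.
  have {}ne : s != t by apply: contra na => /eqP->.
  by apply: XY_W => [|r _ /set2P[]|r _ /set2P[]] //; 
    rewrite /W_adj !inE /= Hp Hq eqxx ne.
- have {e} e : i = i' := ord_inj e; subst i'.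
  have {}ne : s != t by apply: contra na => /eqP->.
  by apply: XY_W => [|r _ /set2P[]|r _ /set2P[]] //; 
    rewrite /W_adj !inE /= Hp Hq eqxx ne.
- have {e} e : i = i' := ord_inj e; subst i'.
  have {}ne : s != t by apply: contra ne => /eqP->.
  by apply: XY_W => [|r _ /set2P[]|r _ /set2P[]] //; 
    rewrite /W_adj !inE /= Hp Hq eqxx ne.
- exact: XY_au.
- have /eqP st : s != t by apply: contra ne => /eqP->.
  have [lt_st|lt_ts|/val_inj//] := ltngtP s t.
    by apply: XY_uu; lia.
  by rewrite setUC; apply: XY_uu; lia.
- exact: XY_bw.
- have /eqP st : s != t by apply: contra ne => /eqP->.
  have [lt_st|lt_ts|/val_inj//] := ltngtP s t.
    by apply: XY_ww; lia.
  by rewrite setUC; apply: XY_ww; lia.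
Qed.

Lemma antipode_adj (i : 'I_k.+1) (s : 'I_d.+1) q :
  XY_vertex (Ny i s) -> XY_vertex q -> (level q == i.+1) || (i == (level q).+1 :> nat) ->
  [set Ny i s; q] \in faces XYcomplex \/ [set Nz i s; q] \in faces XYcomplex.
Proof.
have := ltn_ord i; have := ltn_ord s.
case: q => [||i' t|i' t|t|t] //= ltd ltk Hp Hq iq.
- right; apply: XY_W => [|r _ _|r _ _]; [|by apply/set2P => -[]|by apply/set2P => -[]].
  rewrite /W_adj !inE /=; lia.
- right; apply: XY_W => [|r _ _|r _ _]; [|by apply/set2P => -[]|by apply/set2P => -[]].
  rewrite /W_adj !inE /=; lia.
(* Edges between $X_i$ and $X_{i+1}$ compare the lower index with the upper one, so the test on [s]
   and [t] is reversed when [q] lies below. *)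
- have [st|st] := boolP ((i < i') && (s <= t) || (i' < i) && (t <= s)); [left|right].
    by apply: XY_W => [|r _ /set2P[]|r _ /set2P[]] //;
      rewrite /W_adj !inE /= -!val_eqE /=; lia.
  by apply: XY_W => [|r _ /set2P[]|r _ /set2P[]] //;
      rewrite /W_adj !inE /= -!val_eqE /=; lia.
- have [st|st] := boolP ((i < i') && (s <= t) || (i' < i) && (t <= s)); [right|left].
    by apply: XY_W => [|r _ /set2P[]|r _ /set2P[]] //;
      rewrite /W_adj !inE /= -!val_eqE /=; lia.
  by apply: XY_W => [|r _ /set2P[]|r _ /set2P[]] //;
      rewrite /W_adj !inE /= -!val_eqE /=; lia.
- have i1 : i = 1 :> nat by lia.
  (* $u_t$ is adjacent to the endpoint $y^1_t$ of its edge, and for $s\ne t$ to $z^1_s$, since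
     $a,y^1_t,z^1_s$ is a triangle. *)
  have [st|st] := eqVneq s t; [subst t; left|right]; rewrite setUC; apply: XY_u => //.
  + rewrite -(Ny_vy s i1) setUCA setUid W_face2 /W_adj !inE /=; lia.
  + by move=> r rs; rewrite (Ny_vy s i1); apply: vy_neq; lia.
  + have {}st : s != t :> nat by [].
    apply: W_face3; rewrite /W_adj !inE /= -?val_eqE /= ?inordK //; lia.
- have i1 : i = k :> nat by lia.
  have [st|st] := eqVneq s t; [subst t; left|right]; rewrite setUC; apply: XY_w => //.
  + rewrite -(Ny_vy s i1) setUCA setUid W_face2 /W_adj !inE /=; lia.
  + by move=> r rs; rewrite (Ny_vy s i1); apply: vy_neq; lia.
  + have {}st : s != t :> nat by [].
    apply: W_face3; rewrite /W_adj !inE /= -?val_eqE /= ?inordK //; lia.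
Qed.

Section StableSet.
Variable S : {set vname d k}.
Hypothesis stS : stable (skeleton XYcomplex) S.

Lemma stable_vertex p : p \in S -> XY_vertex p.
Proof. by case/andP: stS => /subsetP SV _ /SV/vertices_XY. Qed.

Lemma stable_nadj p q : p \in S -> q \in S -> p != q ->
  [set p; q] \notin faces XYcomplex.
Proof.
move=> pS qS pq; case/andP: stS => _ /forall_inP/(_ p pS)/forall_inP/(_ q qS).
by rewrite /= /skeleton_adj pq.
Qed.

Lemma stable_same_level p q : p \in S -> q \in S -> level p = level q ->
  p = q \/ q = antipode p.
Proof.
move=> pS qS pq; have [->|ne] := eqVneq p q; [by left|right; apply/eqP].
apply: contraT => na; move: (stable_nadj pS qS ne).
by rewrite level_adj ?stable_vertex.
Qed.

Let L n := [set x in S | level x == n].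

(** Two members of [S] on one level are antipodal, and [antipode] moves only the names of the $y$
    and $z$ vertices. *)
Lemma level_gt1 n : 1 < #|L n| ->
  exists i s, [/\ i = n :> nat, Ny i s \in S & Nz i s \in S].
Proof.
case/card_gt1P=> p [q]; rewrite !inE => -[/andP[pS /eqP pn] /andP[qS /eqP qn] pq].
have [e|e] := stable_same_level pS qS (etrans pn (esym qn)).
  by rewrite e eqxx in pq.
case: p e pS pn pq => [||i s|i s|s|s] /= e pS pn pq;
  try by rewrite e eqxx in pq.
- by exists i, s; rewrite -e.
- by exists i, s; rewrite -e.
Qed.

Lemma level_le2 n : #|L n| <= 2.
Proof.
have [->|[p]] := set_0Vmem (L n); first by rewrite cards0.
rewrite inE => /andP[pS /eqP pn].
apply: leq_trans (_ : #|[set p; antipode p]| <= 2); last by rewrite cards2; case: eqP.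
apply/subset_leq_card/subsetP => q; rewrite inE => /andP[qS /eqP qn].
have [->|->] := stable_same_level pS qS (etrans pn (esym qn)).
  exact: set21.
exact: set22.
Qed.

Lemma level0_le1 : #|L 0| <= 1.
Proof.
rewrite leqNgt; apply/negP => /level_gt1[i [s [i0 /stable_vertex/=]]].
by rewrite i0.
Qed.

Lemma level_antipodes i s q : Ny i s \in S -> Nz i s \in S -> q \in S ->
  (level q == i.+1) || (i == (level q).+1 :> nat) -> False.
Proof.
move=> yS zS qS h.
have nq : level q != i by lia.
have ny : Ny i s != q by apply: contra nq => /eqP<-.
have nz : Nz i s != q by apply: contra nq => /eqP<-.
have [] := antipode_adj (stable_vertex yS) (stable_vertex qS) h.
  by apply/negP/stable_nadj.
by apply/negP/stable_nadj.
Qed.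

(** A level with two members holds an antipodal pair, and then [level_antipodes] empties the other
    level; otherwise each level has at most one. *)
Lemma levels_le2 n : #|L n| + #|L n.+1| <= 2.
Proof.
have [/level_gt1[i [s [ni yS zS]]]|le1] := ltnP 1 #|L n|.
  rewrite [L n.+1](_ : _ = set0) ?cards0 ?addn0 ?level_le2 //.
  apply/setP=> q; rewrite !inE; apply/negP => /andP[qS /eqP qn].
  by apply: (level_antipodes yS zS qS); rewrite qn -ni eqxx.
have [/level_gt1[i [s [ni yS zS]]]|le1'] := ltnP 1 #|L n.+1|.
  rewrite [L n](_ : _ = set0) ?cards0 ?add0n ?level_le2 //.
  apply/setP=> q; rewrite !inE; apply/negP => /andP[qS /eqP qn].
  by apply: (level_antipodes yS zS qS); rewrite qn -ni eqxx orbT.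
exact: (leq_add le1 le1').
Qed.

Lemma card_stable_below n : #|[set x in S | level x < n]| <= n.
Proof. exact: leq_card_levels level0_le1 levels_le2 n. Qed.

End StableSet.

Lemma alpha_XY_leq : alpha (skeleton XYcomplex) <= k.+2.
Proof.
apply/bigmax_leqP => S stS; apply: leq_trans (card_stable_below stS k.+2).
apply/subset_leq_card/subsetP => p pS; rewrite inE pS /=.
by case: p {pS} => // i s; rewrite /= ltnS ltnW.
Qed.

End Levels.

(** Without subdivisions at $b$, level [k.+1] is just $b$. A stable set missing $b$ lies in the
    first [k.+1] levels; one containing $b$ avoids $X_k$, so its other members lie in the first [k]
    levels. *)
Lemma alpha_X_leq (d k j : nat) : 0 < k -> j < d -> alpha (X d k j) <= k.+1.
Proof.
move=> k0 jd; have d0 := leq_ltn_trans (leq0n _) jd.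
apply/bigmax_leqP => S; rewrite -[X d k j]/(skeleton (XYcomplex d k j 0)) => stS.
have SV := stable_vertex jd d0 stS.
have below := card_stable_below k0 jd d0 stS.
have [bS|nbS] := boolP (Nb \in S); last first.
  apply: leq_trans (below k.+1); apply/subset_leq_card/subsetP => p pS.
  rewrite inE pS /=; case: p pS => [||i s|i s|s|s] //= pS; first by rewrite pS in nbS.
  by have /= := SV _ pS; case: (s : nat).
rewrite (cardsD1 Nb) bS; apply: leq_trans (below k).
apply/subset_leq_card/subsetP => p; rewrite !inE => /andP[pb pS]; rewrite pS /=.
have /= := SV _ pS; case: p pb pS => [||i s|i s|s|s] //= _ pS Vp.
- rewrite ltn_neqAle -ltnS ltn_ord andbT; apply/eqP => ik.
  have := stable_nadj stS pS bS isT; apply/negP; rewrite negbK setUC.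
  apply: XY_W => [|r _ /set2P[]//|r]; last by rewrite ltnNge; case: r.
  by rewrite /W_adj !inE /=; lia.
- rewrite ltn_neqAle -ltnS ltn_ord andbT; apply/eqP => ik.
  have := stable_nadj stS pS bS isT; apply/negP; rewrite negbK setUC.
  apply: XY_W => [|r _ /set2P[]//|r]; last by rewrite ltnNge; case: r.
  by rewrite /W_adj !inE /=; lia.
- by case: (s : nat) Vp.
Qed.

(** * Vertex counts *)

Lemma vertices_clique_complex_W d k :
  vertices (skeleton (clique_complex (W d k))) = W_vertices d k.
Proof. by apply/setP => p; rewrite inE -[[set p]]setUid W_face2 eqxx andbT andbb. Qed.

Lemma card_vertices_X d k j : 0 < k -> j < d ->
  #|vertices (X d k j)| = 2 + k * (2 * d - 2) + j.
Proof.
move=> k0; elim: j => [|j IHj] jd.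
  by rewrite /X vertices_clique_complex_W card_vname_W // addn0.
rewrite addnS -IHj 1?ltnW //; apply: card_subdivision_vertices.
  exact: X_edge.
exact: X_fresh.
Qed.

Lemma card_vertices_Y d k j : 0 < k -> j < d ->
  #|vertices (Y d k j)| = 2 + k * (2 * d - 2) + d.-1 + j.
Proof.
move=> k0; elim: j => [|j IHj] jd.
  by rewrite addn0 -(@card_vertices_X d) // prednK.
rewrite addnS -IHj 1?ltnW //; apply: card_subdivision_vertices.
  exact: Y_edge.
exact: Y_fresh.
Qed.

(** * Adjacency after subdivision, and the lower bounds *)

Lemma vertices_X_W d k j p : p \in W_vertices d k -> p \in vertices (X d k j).
Proof.
rewrite -vertices_clique_complex_W /X Xcomplex_subdivisions.
exact: vertices_subdivisions.
Qed.

Lemma X_adj_W d k j (p q : vname d k) : p \in W_vertices d k ->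
  q \in W_vertices d k -> adj (X d k j) p q ->
  W_adj p q /\ (forall s, 0 < s <= j -> Na \in [set p; q] -> vy 1 s \notin [set p; q]).
Proof.
move=> pW qW /andP[pq]; rewrite Xcomplex_subdivisions.
case/(subdivisions_old (leq0n j)) => [s _|pqW nA].
  by apply/set2P => -[e|e]; move: pW qW; rewrite -e !inE.
by split=> //; move: pqW; rewrite /= W_face2 (negPf pq) => /and3P[].
Qed.

Lemma Y_adj_X d k j (p q : vname d k) : p \in vertices (X d k d.-1) ->
  q \in vertices (X d k d.-1) -> adj (Y d k j) p q ->
  adj (X d k d.-1) p q /\
  (forall s, 0 < s <= j -> Nb \in [set p; q] -> vy k s \notin [set p; q]).
Proof.
move=> pX qX /andP[pq]; rewrite Ycomplex_subdivisions.
case/(subdivisions_old (leq0n j)) => [s _|pqX nA].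
  have vX : vw s \notin vertices (X d k d.-1).
    by apply/negP => /X_vertex[|[]//]; rewrite inE.
  by apply/set2P => -[e|e]; move: vX; rewrite e ?pX ?qX.
by split=> //; apply/andP.
Qed.

(** $u_1$ comes from the first stage, and later stages create no edge between it and a vertex of
    $W_{d,k}$; so its link is read off in the clique complex itself. *)
Lemma X_adj_u1 d k j (q : vname d k) : 0 < j < d -> q \in W_vertices d k ->
  adj (X d k j) (vu 1) q ->
  q |: [set Na; vy 1 1] \in faces (clique_complex (W d k)).
Proof.
case/andP=> j0 jd qW /andP[uq]; rewrite Xcomplex_subdivisions.
case/(subdivisions_old j0) => [s /andP[s1 sj]|/subdivision_link qZ _]; last first.
  apply: qZ; last by rewrite eq_sym.
  by rewrite inE /clique sub1set inE.
apply/set2P => -[[/(congr1 val)]|e]; last by move: qW; rewrite -e !inE.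
by rewrite /= !inordK; lia.
Qed.

(* The pairs {y^i_1, z^i_1} with i of the parity of k, together with a if k is
   even: y^i_1 has index i and z^i_1 index i - 1. *)
Definition X_stable d k (i : nat) : vname d k :=
  if odd i == odd k then if i is 0 then Na else vy i 1
  else Nz (inord i.+1) (inord 1).

(** All levels used by [X_stable] have the parity of [k], so two of its vertices are antipodal or at
    least two levels apart, hence non-adjacent already in $W_{d,k}$. *)
Lemma alpha_X_geq d k j : 1 < d -> 0 < k -> k.+1 <= alpha (X d k j).
Proof.
move=> d1 k0.
have fW i : i < k.+1 -> X_stable d k i \in W_vertices d k.
  rewrite /X_stable inE; case: i => [|i] ik; case: eqP => //= io; rewrite !inordK //; lia.
pose g (p : vname d k) : nat :=
  match p with Ny i _ => i | Nz i _ => i.-1 | _ => 0 end.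
apply: (@leq_alpha _ _ _ (X_stable d k) g) => [i ik|i ik|i i' ik ik'].
- rewrite [_ \in _]/(i < k.+1) in ik.
  rewrite /X_stable; case: i ik => [|i] ik; case: eqP => //= io; rewrite inordK //; lia.
- by apply: vertices_X_W; apply: fW.
apply/negP => /(X_adj_W (fW _ ik) (fW _ ik'))[/and3P[_ _]].
suff nA i1 i2 : i1 < k.+1 -> i2 < k.+1 -> ~~ W_arc (X_stable d k i1) (X_stable d k i2).
  by rewrite (negPf (nA _ _ ik ik')) (negPf (nA _ _ ik' ik)).
move=> {i i' ik ik'} ik ik'; rewrite /X_stable.
case: i1 ik => [|i] ik; case: eqP => // io;
  case: i2 ik' => [|i'] ik'; case: eqP => // io';
  rewrite /= -?val_eqE /= ?inordK //; lia.
Qed.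

(* One vertex per level, alternating between y and z and ending with y^k_1, b;
   both y^k_1 b and y^1_1 a have been subdivided, and u_1 is not adjacent to
   z^1_1. *)
Definition Y_stable d k (i : nat) : vname d k :=
  if i is 0 then if odd k then Na else vu 1
  else if i == k.+1 then Nb
  else if odd i == odd k then vy i 1 else Nz (inord i) (inord 1).

Lemma alpha_Y_geq d k j : 1 < d -> 0 < k -> 0 < j < d -> k.+2 <= alpha (Y d k j).
Proof.
move=> d1 k0 jd; have d0 := ltnW d1; have d1' : 0 < d.-1 < d by lia.
have u1d : 0 < 1 <= d.-1 by lia.
have fW i : i < k.+2 -> (Y_stable d k i \in W_vertices d k) || (Y_stable d k i == vu 1).
  rewrite /Y_stable; case: i => [|i] ik; case: ifP => io; rewrite ?inE ?eqxx ?orbT //.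
  by case: ifP => io'; rewrite /= !inordK //; lia.
(* Obtained from the edge $u_1a$, with no subdivision at $b$. *)
have u1X : vu 1 \in vertices (X d k d.-1).
  rewrite inE; have [_ d1d] := andP d1'.
  have := @XY_au d k d.-1 0 k0 d1d d0 (inord 1).
  rewrite inordK; last exact: ltnW; move=> /(_ u1d).
  exact/faces_closed/subsetUl.
have fX i : i < k.+2 -> Y_stable d k i \in vertices (X d k d.-1).
  by case/fW/orP => [/vertices_X_W->//|/eqP->].
apply: (@leq_alpha _ _ _ (Y_stable d k) (@level d k)) => [i ik|i ik|i i' ik ik'].
- rewrite [_ \in _]/(i < k.+2) in ik.
  rewrite /Y_stable; case: i ik => [|i] ik; case: ifP => //= io; first by lia.
  by case: ifP => //= io'; rewrite inordK //; lia.
- rewrite /Y Ycomplex_subdivisions; apply: vertices_subdivisions => //.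
  exact: fX.
(* Only index 0 can give $u_1$, so the vertex of larger index belongs to $W_{d,k}$. *)
wlog lt_ii : i i' ik ik' / i < i'.
  move=> H; have [lt|gt|->] := ltngtP i i'; first exact: H.
    by rewrite adj_sym; apply: H.
  by rewrite adj_irr.
have {}ik' : i' < k.+2 by [].
apply/negP => /(Y_adj_X (fX _ ik) (fX _ ik')) [].
have i'W : Y_stable d k i' \in W_vertices d k.
  by case/orP: (fW _ ik') => // /eqP; case: i' {ik'} lt_ii => // i' _;
    rewrite /Y_stable; do 2!case: ifP => // _.
case: i' lt_ii ik' i'W => // i' lt_ii ik' i'W.
case: i ik lt_ii => [|i] ik lt_ii.
  case: (boolP (odd k)) => ko.
    have -> : Y_stable d k 0 = Na by rewrite /Y_stable ko.
    case/X_adj_W => //; first by rewrite inE.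
    case/and3P=> _ _ aN nN _; move: aN nN; rewrite /Y_stable.
    case: ifP => // ki; case: ifP => io; rewrite /= ?inordK //; try lia.
    by rewrite orbF => /eqP-> /(_ 1 u1d (set21 _ _)); rewrite set22.
  have -> : Y_stable d k 0 = vu 1 by rewrite /Y_stable (negPf ko).
  (* A neighbour of $u_1$ in the sequence would be joined to $a$, hence on level 1; for [k] even
     that vertex is $z^1_1$, which is not adjacent to $y^1_1$. *)
  move/(X_adj_u1 d1' i'W) => F _.
  have : [set Y_stable d k i'.+1; Na] \in faces (clique_complex (W d k)).
    by apply: faces_closed F; rewrite setUS // subsetUl.
  have : [set Y_stable d k i'.+1; vy 1 1] \in faces (clique_complex (W d k)).
    by apply: faces_closed F; rewrite setUS // subsetUr.
  rewrite !W_face2 => /and3P[_ _ qy] /and3P[_ _]; move: qy; rewrite /Y_stable.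
  case: ifP => ki; first by move=> _; rewrite /W_adj !inE.
  case: ifP => io; rewrite /W_adj !inE /=; [move=> _ | ];
    rewrite -?val_eqE /= ?inordK //; lia.
have iW : Y_stable d k i.+1 \in W_vertices d k.
  by case/orP: (fW _ ik) => // /eqP; rewrite /Y_stable; do 2!case: ifP => // _.
case=> /X_adj_W[] // /and3P[_ _] aN _; move: aN; rewrite /Y_stable.
have -> : (i.+1 == k.+1) = false by lia.
case: (eqVneq i'.+1 k.+1) => ik1; last first.
  by case: ifP => io; case: ifP => io'; rewrite /= -?val_eqE /= ?inordK //; lia.
case: ifP => io; rewrite /= ?inordK //; try lia.
(* The remaining edge $by^k_1$ was subdivided at the first stage at $b$, which took place since [j]
   is positive. *)
move=> /eqP-> /(_ 1); case/andP: jd => -> _ /(_ isT (set22 _ _)).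
by rewrite set21.
Qed.

(** * The values of $\alpha$ and the rational identities *)

Import GRing.Theory Num.Theory.
Local Open Scope ring_scope.

Theorem theorem2p1 :
  (forall d k j : nat, (2 <= d)%N -> (1 <= k)%N -> (j <= d - 1)%N ->
     alpha (X d k j) = (k + 1)%N /\
     (k + 1)%:R =
       (#|vertices (X d k j)|%:R - 2 - j%:R) / (2 * d%:R - 2) + 1 :> rat) /\
  (forall d k j : nat, (3 <= d)%N -> (1 <= k)%N -> (1 <= j <= d - 1)%N ->
     alpha (Y d k j) = (k + 2)%N /\
     (k + 2)%:R =
       (#|vertices (Y d k j)|%:R - 2 + (d%:R - 1 - j%:R)) / (2 * d%:R - 2) + 1
         :> rat).
Proof.
have denom d : (2 <= d)%N -> (2 * d%:R - 2 : rat) = (2 * d - 2)%:R.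
  by move=> d2; rewrite natrB ?natrM //; lia.
have denom_neq0 d : (2 <= d)%N -> (2 * d - 2)%:R != 0 :> rat.
  by move=> d2; rewrite pnatr_eq0; lia.
split=> d k j d2 k0 jd.
  have jltd : (j < d)%N by lia.
  rewrite addn1; split.
    by apply/eqP; rewrite eqn_leq alpha_X_leq ?alpha_X_geq.
  rewrite card_vertices_X // denom // 2!natrD natrM addrAC addrK addrAC subrr add0r.
  by rewrite mulfK ?denom_neq0 // -natr1.
case/andP: jd => j0 jd; have jltd : (j < d)%N by lia.
have d2' := ltnW d2; have d0 := ltnW d2'.
rewrite addn2; split.
  apply/eqP; rewrite eqn_leq alpha_Y_geq ?j0 // andbT.
  rewrite /Y Ycomplex_subdivisions; apply: alpha_XY_leq => //; lia.
(* The $d-1$ vertices $u_s$, the $j$ vertices $w_s$ and the correction $d-1-j$ add up to one more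
   block of $2d-2$. *)
have -> : #|vertices (Y d k j)|%:R - 2 + (d%:R - 1 - j%:R) =
    k.+1%:R * (2 * d - 2)%:R :> rat.
  rewrite card_vertices_Y // -denom // !natrD natrM -denom // -subn1 natrB //.
  rewrite -natr1; ring.
by rewrite denom // mulfK ?denom_neq0 // -natr1.
Qed.
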